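(* Let $\xi_1$ be a heavy-tailed random variable. If $$\limsup_{x\to\infty}\frac{R_{\xi_1}(x)}{x}=\infty,$$ then $\xi_1$ satisfies condition (C): there exist $\gamma>0$ and a segmentation $1<s_1<t_1<s_2<t_2<\cdots$ such that $R_{\xi_1}(x)/x\geq\gamma$ for all $x\in[s_i,t_i]$, $i=1,2,\dots$.
   Context: A real random variable $\xi$ is heavy-tailed if $\mathbb{E}e^{\lambda\xi}=\infty$ for all $\lambda>0$. The cumulative hazard of $\xi$ is $R_\xi(x):=-\log\mathbb{P}(\xi>x)$, $x\in\mathbb{R}$. A segmentation is a sequence $1<s_1<t_1<s_2<t_2<\cdots$ increasing to infinity with $\lim_{i\to\infty}s_i/t_i=0$. *)

(* Defs.v *)
From HB Require Import structures.
From mathcomp Require Import all_boot all_order all_algebra.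
From mathcomp Require Import all_classical all_reals all_analysis.

Set Implicit Arguments.
Unset Strict Implicit.
Unset Printing Implicit Defensive.

Import Order.TTheory GRing.Theory Num.Theory.
Import numFieldNormedType.Exports.

Local Open Scope classical_set_scope.
Local Open Scope ring_scope.

Definition heavy_tailed (d : measure_display) (T : measurableType d)
    (R : realType) (P : probability T R) (X : {RV P >-> R}) : Prop :=
  forall l : R, 0 < l -> 'M_P X l = +oo%E.

(* Extended-real valued, since lne 0 = -oo: the hazard is +oo at every x with
   P(X > x) = 0. *)
Definition cumulative_hazard (d : measure_display) (T : measurableType d)
    (R : realType) (P : probability T R) (X : {RV P >-> R}) (x : R) : \bar R :=
  (- lne (ccdf X x))%E.

Definition hazard_ratio (d : measure_display) (T : measurableType d)
    (R : realType) (P : probability T R) (X : {RV P >-> R}) (x : R) : \bar R :=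
  (cumulative_hazard X x / x%:E)%E.

(* The pair (s i, t i) is the segment usually written (s_(i+1), t_(i+1)). *)
Definition segmentation (R : realType) (s t : nat -> R) : Prop :=
  [/\ 1 < s 0%N,
      forall i, s i < t i,
      forall i, t i < s i.+1,
      s i @[i --> \oo] --> +oo /\ t i @[i --> \oo] --> +oo
    & s i / t i @[i --> \oo] --> (0 : R)].

Definition condition_C (d : measure_display) (T : measurableType d)
    (R : realType) (P : probability T R) (X : {RV P >-> R}) : Prop :=
  exists2 gamma : R, 0 < gamma &
    exists s t : nat -> R, segmentation s t /\
      forall i x, s i <= x <= t i -> (gamma%:E <= hazard_ratio X x)%E.

(* Main.v *)
Require Import Defs.
From mathcomp Require Import all_boot all_order all_algebra.
From mathcomp Require Import all_classical all_reals all_analysis.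
Import Order.TTheory GRing.Theory Num.Theory.
Import numFieldNormedType.Exports.
Local Open Scope classical_set_scope.
Local Open Scope ring_scope.

(** The cumulative hazard is nondecreasing, so one large value of the ratio
    propagates to the right: if R(s) >= k s with s > 0, then every x in
    [s, k s] satisfies R(x) >= R(s) >= k s >= x, i.e. R(x) / x >= 1
    ([hazard_ratio_ge1]).  An infinite upper limit supplies, for every k, such
    points s beyond any prescribed bound ([limf_esup_pinfty_frequently]).
    Taking k = i + 2 and placing s_(i+1) beyond t_i = (i + 2) s_i yields
    segments whose endpoint ratio s_i / t_i = 1 / (i + 2) tends to 0, so
    condition (C) holds with gamma = 1. *)

Lemma limf_esup_pinfty_frequently (R : realType) (h : R -> \bar R) (k m : R) :
  limf_esup h +oo%R = +oo%E -> exists2 x, m < x & (k%:E < h x)%E.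
Proof.
move=> hoo; have nbhs_m : (+oo%R : set_system R) [set x | m < x].
  exact: nbhs_pinfty_gt (num_real m).
have : (limf_esup h +oo%R <= ereal_sup (h @` [set x | (m < x)%R]))%E.
  by apply: ereal_inf_lbound; exists [set x | m < x].
rewrite hoo leye_eq => /eqP supoo.
have : (k%:E < ereal_sup (h @` [set x | (m < x)%R]))%E by rewrite supoo ltry.
by move=> /ereal_sup_gt[_ [x /= mx <-] khx]; exists x.
Qed.

Lemma cumulative_hazard_nondecreasing (d : measure_display)
    (T : measurableType d) (R : realType) (P : probability T R)
    (X : {RV P >-> R}) (x y : R) :
  x <= y -> (cumulative_hazard X x <= cumulative_hazard X y)%E.
Proof.
move=> xy; have ccdf_ge0 z : ccdf X z \in `[0%E, +oo%E].
  by rewrite in_itv/= leey andbT; exact: measure_ge0.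
by rewrite /cumulative_hazard leeN2 lee_lne//; exact: ccdf_nonincreasing.
Qed.

Lemma hazard_ratio_ge (d : measure_display) (T : measurableType d)
    (R : realType) (P : probability T R) (X : {RV P >-> R}) (k x : R) :
  0 < x -> (k%:E <= hazard_ratio X x)%E = ((k * x)%:E <= cumulative_hazard X x)%E.
Proof.
by move=> x0; rewrite /hazard_ratio inver gt_eqF// lee_pdivlMr// EFinM.
Qed.

(** The length of the segment grows with the ratio k attained at its left
    endpoint, while the lower bound 1 obtained on it does not depend on k. *)
Lemma hazard_ratio_ge1 (d : measure_display) (T : measurableType d)
    (R : realType) (P : probability T R) (X : {RV P >-> R}) (k s x : R) :
  0 < s -> (k%:E <= hazard_ratio X s)%E -> s <= x <= k * s ->
  (1 <= hazard_ratio X x)%E.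
Proof.
move=> s0; rewrite hazard_ratio_ge// => ks /andP[sx xks].
rewrite hazard_ratio_ge ?(lt_le_trans s0)// mul1r.
apply: le_trans (cumulative_hazard_nondecreasing _ _ _ _ X _ _ sx).
by apply: le_trans ks; rewrite lee_fin.
Qed.

(** Any such s satisfies s i > i + 1, which is what makes both endpoints tend
    to infinity. *)
Lemma segmentation_scaled (R : realType) (s : nat -> R) :
  1 < s 0%N -> (forall i, i.+2%:R * s i < s i.+1) ->
  segmentation s (fun i => i.+2%:R * s i).
Proof.
move=> s0_gt1 sS; have s_gt i : i.+1%:R < s i.
  elim: i => // i IHi; apply: le_lt_trans (sS i).
  by rewrite ler_peMr// ltW// (le_lt_trans _ IHi)// ler1n.
have s_gt0 i : 0 < s i by apply: lt_trans (s_gt i).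
have lt_st i : s i < i.+2%:R * s i by rewrite ltr_pMl// ltr1n.
have s_cvgy : s i @[i --> \oo] --> +oo.
  apply: ger_cvgy cvgr_idn; apply: nearW => i.
  by apply: le_trans (ltW (s_gt i)); rewrite ler_nat.
split => //.
- split => //; apply: ger_cvgy s_cvgy; apply: nearW => i; exact/ltW/lt_st.
- have -> : (fun i => s i / (i.+2%:R * s i)) = (fun i => @harmonic R i.+1).
    by apply/funext => i; rewrite invfM mulrCA divff ?mulr1// gt_eqF.
  by rewrite (cvg_shiftS (@harmonic R)); exact: cvg_harmonic.
Qed.

Theorem corollary1p5 (d : measure_display) (T : measurableType d)
    (R : realType) (P : probability T R) (xi1 : {RV P >-> R}) :
  heavy_tailed xi1 ->
  limf_esup (hazard_ratio xi1) +oo%R = +oo%E ->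
  condition_C xi1.
Proof.
move=> _ ratio_oo.
have [f f_gt f_ratio] : exists2 f : R -> R -> R,
    (forall k m, m < f k m) & forall k m, (k%:E <= hazard_ratio xi1 (f k m))%E.
  have /choice[f fP] (km : R * R) :
      exists x, km.2 < x /\ (km.1%:E < hazard_ratio xi1 x)%E.
    have [x] := limf_esup_pinfty_frequently _ _ km.1 km.2 ratio_oo.
    by exists x.
  by exists (fun k m => f (k, m)) => k m; have [? /ltW] := fP (k, m).
pose s := fix s (i : nat) : R :=
  if i is j.+1 then f i.+2%:R (j.+2%:R * s j) else f 2 1.
have s_ratio i : (i.+2%:R%:E <= hazard_ratio xi1 (s i))%E.
  by case: i => [|i]; exact: f_ratio.
have s0_gt1 : 1 < s 0%N by exact: f_gt.
have sS i : i.+2%:R * s i < s i.+1 by exact: f_gt.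
have s_gt0 i : 0 < s i.
  elim: i => [|i IHi]; first exact: lt_trans s0_gt1.
  by apply: lt_trans (sS i); rewrite mulr_gt0.
exists 1 => //; exists s, (fun i => i.+2%:R * s i); split.
  exact: segmentation_scaled.
by move=> i x; exact: hazard_ratio_ge1.
Qed.
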